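(* Let $G$ be a digraph. Then the graph algebra $\mathbb{A}(G)$ is not antiassociative if and only if all of the following conditions hold. (i) Every nontrivial strongly connected component of $G$ is a whirl. (ii) There is no path from a nontrivial strongly connected component of $G$ to another. (iii) There is a finite upper bound on the length of the pleasant paths in $G$. (iv) There is a finite upper bound on the numbers $m$ such that $G$ contains an $m$-whirl as a strongly connected component.
   Context: A digraph is a pair $G=(V,E)$ with $V$ a nonempty (possibly infinite) set and $E\subseteq V^2$ (loops allowed). A walk of length $\ell$ is a sequence $v_0\to v_1\to\dots\to v_\ell$ of consecutive edges; a path is a walk with pairwise distinct vertices. Two vertices are strongly connected if each is reachable from the other by a walk (possibly of length $0$); the strongly connected components are the subgraphs induced on the classes of this equivalence relation. A component is trivial if it has one vertex and no edge; otherwise it is nontrivial. A path from one component to another is a path from a vertex of the first to a vertex of the second, the two components being distinct. A walk is pleasant if all its vertices belong to trivial strongly connected components (every pleasant walk is a path). For an integer $m\ge1$, a digraph $(V,E)$ is an $m$-whirl if there is a partition $\{B_0,\dots,B_{m-1}\}$ of $V$ into $m$ nonempty blocks such that for all $x,y\in V$: $(x,y)\in E$ iff $x\in B_i$ and $y\in B_{i+1}$ for some $i\in\{0,\dots,m-1\}$ (indices modulo $m$). A whirl is an $m$-whirl for some $m\ge 1$. Graph algebra: $\mathbb{A}(G)=(V\cup\{\infty\};\circ,\infty)$ with $\infty\notin V$, where $x\circ y=x$ if $(x,y)\in E$ and $x\circ y=\infty$ otherwise. $B_n$ is the set of bracketings of size $n$: groupoid terms obtained from the string $x_1x_2\cdots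 x_n$ of distinct variables (in this order) by inserting parentheses so that the product is unambiguous. $\mathbb{A}(G)$ satisfies $t\approx t'$ if $t$ and $t'$ take equal values under all assignments of elements of $V\cup\{\infty\}$ to the variables. $\mathbb{A}(G)$ is antiassociative if it satisfies no identity $t\approx t'$ with $t,t'\in B_n$, $t\ne t'$, for any $n\ge 1$. *)

(* Defs.v *)
From HB Require Import structures.
From mathcomp Require Import all_boot.
From mathcomp Require Import boolp classical_sets.

Set Implicit Arguments.
Unset Strict Implicit.
Unset Printing Implicit Defensive.

Local Open Scope classical_set_scope.

Record digraph : Type := Digraph {
  vertex :> Type;
  vertex_inhabited : inhabited vertex;
  edge : set (vertex * vertex)
}.

Arguments edge : clear implicits.

Section Digraphs.
Variable G : digraph.

Definition arc : rel G := fun x y => (x, y) \in edge G.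

(* A nonempty vertex sequence x :: p represents a walk of length [size p]. *)
Definition walk (x : G) (p : seq G) : bool := path arc x p.

(* [{classic G}] is the type G with its classical decidable equality. *)
Definition dipath (x : G) (p : seq G) : bool :=
  walk x p && uniq (x :: p : seq {classic G}).

Definition reachable (x y : G) : Prop := exists2 p, walk x p & last x p = y.

Definition strongly_connected (x y : G) : Prop := reachable x y /\ reachable y x.

Definition scc (x : G) : set G := [set y | strongly_connected x y].

Lemma scc_refl (x : G) : scc x x.
Proof. by split; exists [::]. Qed.

Lemma scc_inhabited (x : G) : inhabited {y : G | scc x y}.
Proof. exact: (inhabits (exist _ x (scc_refl x))). Qed.

(* The strongly connected component of x: the subgraph induced on [scc x]. *)
Definition component (x : G) : digraph :=
  Digraph (scc_inhabited x) [set e | edge G (sval e.1, sval e.2)].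

Definition trivial : Prop :=
  (exists x : G, [set: G] = [set x]) /\ edge G = set0.

(* [ordS i] is i + 1 modulo m. *)
Definition is_whirl (m : nat) : Prop :=
  0 < m /\ exists B : 'I_m -> set G,
    partition [set: 'I_m] B [set: G] /\
    forall x y : G, edge G (x, y) <-> exists i, B i x /\ B (ordS i) y.

Definition whirl : Prop := exists m, is_whirl m.

End Digraphs.

Definition pleasant (G : digraph) (x : G) (p : seq G) : bool :=
  walk x p && all (fun v => `[< trivial (component v) >]) (x :: p).

(* The carrier of the graph algebra is [option G], with [None] as infinity. *)
Definition graph_mul (G : digraph) (a b : option G) : option G :=
  match a, b with
  | Some x, Some y => if (x, y) \in edge G then Some x else None
  | _, _ => None
  end.

Inductive term : Type := Var of nat | Mul of term & term.

Fixpoint vars (t : term) : seq nat :=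
  match t with
  | Var i => [:: i]
  | Mul t1 t2 => vars t1 ++ vars t2
  end.

Definition bracketing (n : nat) (t : term) : Prop := vars t = iota 1 n.

Section Groupoids.
Variables (A : Type) (op : A -> A -> A).

Fixpoint eval (h : nat -> A) (t : term) : A :=
  match t with
  | Var i => h i
  | Mul t1 t2 => op (eval h t1) (eval h t2)
  end.

Definition satisfies (t t' : term) : Prop :=
  forall h : nat -> A, eval h t = eval h t'.

Definition antiassociative : Prop :=
  forall n t t', 0 < n -> bracketing n t -> bracketing n t' -> t <> t' ->
    ~ satisfies t t'.

End Groupoids.

(* Main.v *)
Require Import Defs.
From mathcomp Require Import all_boot.
From mathcomp Require Import boolp classical_sets.
(* Gives [arc] back its meaning for digraphs: [path.arc] is a sub-arc of a
   cyclic sequence. *)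
Import Defs.

(** A bracketing of x_1 ... x_n is the same thing as a rooted ordered tree on
    its variables, numbered in preorder: each product joins the leading
    variables of its two factors. Under an assignment of vertices the bracketing
    is finite exactly when the assignment is a homomorphism from the tree to
    the digraph, and its value is then the image of the root ([eval_hom]). So
    two bracketings of the same size satisfy an identity iff their trees have
    the same homomorphisms to G ([satisfiesP]).

    Suppose that two different trees have the same homomorphisms. A tree is
    determined by its sequence of depths ([depths_inj]); let d < d' be the
    depths of the first vertex i at which the sequences differ. Both trees agree
    before i, so i is attached to the same branch, at its vertex of depth d - 1
    in one tree and d' - 1 in the other. Maps that depend only on the depth,
    through a walk w before i and through another walk w' from i on, are
    homomorphisms of one tree and hence of the other, which forces one new arc
    of G ([identity_transfer]). Taking w' = w along a long pleasant path gives
    an arc that closes a cycle, and along an m-whirl it gives that m divides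
    d' - d; hence (iii) and (iv). For (i) and (ii) consider the vertices lying
    on walks from nontrivial components to nontrivial components. Walks among
    them extend indefinitely in both directions, so the new arcs say that the
    two ends of every walk of length d' - d have the same out-neighbours in this
    region ([transfer_twins]). It follows that vertices with a common
    out-neighbour, or a common in-neighbour, are twins, that arcs only depend on
    the twin classes of their ends, and that every arc lies on a cycle
    ([twins_of_common_succ], [twins_of_common_pred], [arc_twin],
    [arc_reversible]). So the region has no arc between different components,
    and each component is the whirl formed by its twin classes
    ([region_whirl]).

    Conversely, under (i)-(iv) compare two trees, each made of a long trunk and
    a long branch attached to it far from both ends of the trunk, the points of
    attachment being M! levels apart, where M bounds the whirl sizes. A long walk
    must enter a nontrivial component, since pleasant paths are short, and it can
    visit only one. So the middle of the trunk and the beginning of the branch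
    are mapped to one whirl, whose size divides M!, and both points of attachment
    go to the same block: the two trees have the same homomorphisms
    ([branch_moves]). *)

Set Implicit Arguments.
Unset Strict Implicit.
Unset Printing Implicit Defensive.

(** * Reachability and strong components *)

Section Reachability.
Variable G : digraph.
Implicit Types (x y z : G) (p : seq G) (g : nat -> G).

Lemma arcP x y : arc x y <-> edge G (x, y).
Proof. by rewrite /arc in_setE. Qed.

Lemma reachable_refl x : reachable x x.
Proof. by exists [::]. Qed.

Lemma reachable_trans x y z : reachable x y -> reachable y z -> reachable x z.
Proof.
move=> [p wp <-] [q wq <-]; exists (p ++ q); last by rewrite last_cat.
by rewrite /walk cat_path; apply/andP.
Qed.

Lemma reachable_arc x y : arc x y -> reachable x y.
Proof. by move=> xy; exists [:: y] => //; rewrite /walk /= xy. Qed.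

Definition cyclic x : Prop := exists2 y, arc x y & reachable y x.

Lemma nontrivialP x : ~ trivial (component x) <-> cyclic x.
Proof.
split; last first.
  move=> [y xy yx] [_ E].
  have sy : scc x y by split=> //; exact: reachable_arc.
  have : edge (component x) (exist _ x (scc_refl x), exist _ y sy).
    by apply/arcP.
  by rewrite E.
move=> ntx; apply: contrapT => ncx; apply: ntx.
have only_x y : scc x y -> y = x.
  move=> [[[|z p] /= wp <-] yx] //; case: ncx; exists z.
    by case/andP: wp.
  apply: reachable_trans yx; exists p => //; by case/andP: wp.
split.
  exists (exist _ x (scc_refl x)); apply/seteqP; split=> [[y sy] _|] //=.
  by apply: eq_exist; exact: only_x.
apply/seteqP; split=> [[[y sy] [z sz]] /= /arcP yz|] //=.
case: ncx; exists x; last exact: reachable_refl.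
by rewrite -{1}(only_x _ sy) -(only_x _ sz).
Qed.

Lemma trivialP x : trivial (component x) <-> ~ cyclic x.
Proof.
split=> [tx /nontrivialP //|ncx]; apply: contrapT => /nontrivialP; exact: ncx.
Qed.

Lemma scc_sym x y : scc x y -> scc y x.
Proof. by case. Qed.

Lemma scc_trans x y z : scc x y -> scc y z -> scc x z.
Proof.
by move=> [xy yx] [yz zy]; split; [apply: reachable_trans yz | apply: reachable_trans yx].
Qed.

Lemma scc_eq x y : scc x y -> scc x = scc y.
Proof.
move=> xy; apply/seteqP; split=> z; apply: scc_trans => //; exact: scc_sym.
Qed.

Lemma reachable_dipath x y : reachable x y -> exists2 p, dipath x p & last x p = y.
Proof.
case=> p wp <-; case: (@shortenP {classic G} _ x p wp) => p' wp' up' _.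
by exists p' => //; apply/andP.
Qed.

Definition arcs_on g a b : Prop := forall i, a <= i < b -> arc (g i) (g i.+1).

Lemma reachable_arcs_on g a b i j :
  arcs_on g a b -> a <= i -> i <= j -> j <= b -> reachable (g i) (g j).
Proof.
move=> gab ai /subnKC <-; elim: (j - i) => [|k IH] kb.
  by rewrite addn0; exact: reachable_refl.
rewrite addnS in kb *; apply: reachable_trans (IH (ltnW kb)) _.
by apply/reachable_arc/gab; rewrite kb (leq_trans ai) ?leq_addr.
Qed.

Lemma arcs_on_walk g a l :
  arcs_on g a (a + l) -> walk (g a) [seq g i | i <- iota a.+1 l].
Proof.
elim: l a => [|l IH] a //= gal.
rewrite gal ?leqnn /= ?addnS ?ltnS ?leq_addr //.
by apply: IH => i /andP[ai ib]; apply: gal; rewrite (ltnW ai) addnS -addSn.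
Qed.

Lemma pleasant_dipath x p : pleasant x p -> dipath x p.
Proof.
case/andP=> wp tp; apply/andP; split=> //.
elim: p x wp tp => [|y p IH] x //= /andP[xy wp] /andP[/asboolP/trivialP ncx tp].
have /= -> := IH y wp tp; rewrite andbT.
apply/negP => xi; apply: ncx; exists y => //.
move: xi; rewrite inE => /orP[/eqP->|]; first exact: reachable_refl.
move=> xi; case/splitPr: xi wp => p1 p2.
rewrite /walk cat_path /= => /andP[w1 /andP[w2 _]].
by exists (rcons p1 x); rewrite ?last_rcons // /walk rcons_path w1.
Qed.

(** The block numbers, lifted to colours of the ambient vertices that are only
    meaningful modulo [m]: a walk in a whirl can then be followed by plain
    arithmetic, without ordinals or elements of a subtype. *)
Lemma whirl_colouring x m : is_whirl (component x) m <->
  0 < m /\ exists c : G -> nat,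
    (forall i, exists2 y, scc x y & c y = i %[mod m]) /\
    (forall y z, scc x y -> scc x z ->
       (arc y z <-> c z = (c y).+1 %[mod m])).
Proof.
split=> [[m0 [B [[cov tr ne] BE]]]|[m0 [c [sur cE]]]]; split=> //.
  have colP (y : G) : exists k : nat, forall sy : scc x y,
      exists2 i : 'I_m, k = nat_of_ord i & B i (exist _ y sy).
    have [sy|nsy] := pselect (scc x y); last by exists 0.
    have : setT (exist _ y sy : component x) by [].
    rewrite -cov => -[i _ Bi]; exists i => sy'; exists i => //.
    by rewrite (Prop_irrelevance sy' sy).
  have [c cP] := choice colP; exists c.
  have colE i y (sy : scc x y) : B i (exist _ y sy) -> c y = i.
    move=> Bi; have [j -> Bj] := cP y sy.
    by congr (nat_of_ord _); apply: (tr j i) => //; exists (exist _ y sy).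
  split=> [i|y z sy sz].
    have [[y sy] By] := ne (Ordinal (ltn_pmod i m0)) I.
    by exists y => //; rewrite (colE _ _ _ By) /= modn_mod.
  split=> [/arcP yz|E].
    have [i [Bi Bj]] := (BE (exist _ y sy) (exist _ z sz)).1 yz.
    by rewrite (colE _ _ _ Bi) (colE _ _ _ Bj) /= modn_mod.
  apply/arcP; apply: (BE (exist _ y sy) (exist _ z sz)).2.
  have [i ci Bi] := cP y sy; have [j cj Bj] := cP z sz.
  exists i; split=> //; suff -> : ordS i = j by [].
  by apply: val_inj; rewrite /= -ci -E cj modn_small.
exists (fun (i : 'I_m) (y : component x) => c (sval y) = i %[mod m]); split.
  split.
  - apply/seteqP; split=> // y _; exists (Ordinal (ltn_pmod (c (sval y)) m0)) => //=.
    by rewrite modn_mod.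
  - move=> i j _ _ [y [/= yi yj]]; apply: val_inj => /=.
    by rewrite -(modn_small (ltn_ord i)) -(modn_small (ltn_ord j)) -yi.
  - by move=> i _; have [y sy E] := sur i; exists (exist _ y sy).
move=> [y sy] [z sz]; split=> [/arcP/(cE _ _ sy sz) E|[i /= [yi zi]]].
  exists (Ordinal (ltn_pmod (c y) m0)); rewrite /= !modn_mod; split=> //.
  by rewrite E -addn1 -modnDml addn1.
apply/arcP/(cE _ _ sy sz); rewrite zi modn_mod -addn1 -modnDml -yi.
by rewrite modnDml addn1.
Qed.

End Reachability.

(** * Bracketings, homomorphisms and depth sequences *)

Fixpoint lead (t : term) : nat :=
  match t with Var i => i | Mul t1 _ => lead t1 end.

(** The depths of the variables in the tree of [t], in preorder, when the root
    is given depth [b]. *)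
Fixpoint depths (b : nat) (t : term) : seq nat :=
  match t with
  | Var _ => [:: b]
  | Mul t1 t2 => depths b t1 ++ depths b.+1 t2
  end.

Lemma size_depths b t : size (depths b t) = size (vars t).
Proof. by elim: t b => //= t1 IH1 t2 IH2 b; rewrite !size_cat IH1 IH2. Qed.

Lemma vars_lead t : vars t = lead t :: behead (vars t).
Proof. by elim: t => //= t1 -> t2 _. Qed.

Lemma bracketing_lead n t : 0 < n -> bracketing n t -> lead t = 1.
Proof. by case: n => // n _; rewrite /bracketing vars_lead => -[]. Qed.

Lemma depths_shape b t : exists r,
  [/\ depths b t = b :: r, all (ltn b) r & path (fun i j => j <= i.+1) b r].
Proof.
elim: t b => [i|t1 IH1 t2 IH2] b; first by exists [::].
have [r1 [E1 a1 p1]] := IH1 b; have [r2 [E2 a2 p2]] := IH2 b.+1.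
exists (r1 ++ b.+1 :: r2); rewrite /= E1 E2; split=> //.
  rewrite all_cat a1 /= ltnSn /=.
  by apply: sub_all a2 => i /= /ltnW.
rewrite cat_path p1 /= p2 andbT ltnS.
have := mem_last b r1; rewrite inE => /orP[/eqP->//|].
by move=> /(allP a1) /= /ltnW.
Qed.

Lemma cat_cons_inj (T : eqType) (a : T) l1 l2 r1 r2 :
  a \notin r1 -> a \notin r2 -> l1 ++ a :: r1 = l2 ++ a :: r2 ->
  l1 = l2 /\ r1 = r2.
Proof.
move=> a1 a2; elim: l1 l2 => [|b l1 IH] [|c l2] //=.
- by case.
- by case=> _ E; rewrite E mem_cat inE eqxx orbT in a1.
- by case=> _ E; rewrite -E mem_cat inE eqxx orbT in a2.
- by case=> -> /IH [-> ->].
Qed.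

(** The right factor of a product starts at the last variable whose depth is
    one more than that of the root, so the depths tell where to split. *)
Lemma depths_inj b t t' :
  vars t = vars t' -> depths b t = depths b t' -> t = t'.
Proof.
have nonnil c u : 0 < size (depths c u) by have [r [-> _ _]] := depths_shape c u.
elim: t b t' => [i|t1 IH1 t2 IH2] b [j|u1 u2] /=; first by case=> ->.
- move=> _ /(congr1 size); rewrite size_cat => E.
  by have := leq_add (nonnil b u1) (nonnil b.+1 u2); rewrite -E.
- move=> _ /(congr1 size); rewrite size_cat => E.
  by have := leq_add (nonnil b t1) (nonnil b.+1 t2); rewrite E.
move=> V.
have [r2 [E2 a2 _]] := depths_shape b.+1 t2.
have [s2 [F2 b2 _]] := depths_shape b.+1 u2.
have notin r : all (ltn b.+1) r -> b.+1 \notin r.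
  by move=> ar; apply/negP => /(allP ar); rewrite /= ltnn.
rewrite E2 F2 => /cat_cons_inj [||E1 E]; [exact: notin..|].
have sz : size (vars t1) = size (vars u1) by rewrite -!(size_depths b) E1.
move/eqP: V; rewrite eqseq_cat // => /andP[/eqP V1 /eqP V2].
by rewrite (IH1 b u1) // (IH2 b.+1 u2) // E2 F2 E.
Qed.

Lemma first_difference (T : eqType) (l l' : seq T) :
  size l = size l' -> l <> l' -> exists P a a' R R',
  [/\ l = P ++ a :: R, l' = P ++ a' :: R' & a <> a'].
Proof.
elim: l l' => [|a l IH] [|a' l'] //= [sz] ne.
have [E|/eqP na] := eqVneq a a'; last by exists [::], a, a', l, l'.
have [|P [b [b' [R [R' [-> -> nb]]]]]] := IH l' sz.
  by move=> El; apply: ne; rewrite E El.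
by exists (a' :: P), b, b', R, R'; rewrite E.
Qed.

Section Homomorphisms.
Variable G : digraph.
Implicit Types (g w s : nat -> G) (l : seq (nat * G)).

(** Homomorphisms from the tree of [t] to [G]. *)
Fixpoint hom g (t : term) : bool :=
  match t with
  | Var _ => true
  | Mul t1 t2 => [&& hom g t1, hom g t2 & arc (g (lead t1)) (g (lead t2))]
  end.

Lemma eval_hom g t :
  eval (@graph_mul G) (Some \o g) t = if hom g t then Some (g (lead t)) else None.
Proof.
elim: t => //= t1 -> t2 ->; case: (hom g t1) => //=.
by case: (hom g t2).
Qed.

Lemma eval_infinity (h : nat -> option G) t i :
  i \in vars t -> h i = None -> eval (@graph_mul G) h t = None.
Proof.
move=> it hi; elim: t it => /= [j|t1 IH1 t2 IH2].
  by rewrite inE => /eqP <-.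
rewrite mem_cat => /orP[/IH1|/IH2] -> //.
by case: (eval _ h t1).
Qed.

Lemma eq_in_eval (A : Type) (op : A -> A -> A) (h h' : nat -> A) t :
  {in vars t, h =1 h'} -> eval op h t = eval op h' t.
Proof.
elim: t => /= [i|t1 IH1 t2 IH2] E; first by apply: E; rewrite inE.
by rewrite IH1 ?IH2 // => i it; apply: E; rewrite mem_cat it ?orbT.
Qed.

(** Bracketings of the same size contain the same variables, so they are both
    infinite as soon as one variable is, and otherwise they can only take the
    value of their common leading variable. *)
Lemma satisfiesP n t t' : 0 < n -> bracketing n t -> bracketing n t' ->
  (satisfies (@graph_mul G) t t' <-> forall g, hom g t = hom g t').
Proof.
move=> n0 bt bt'; have E := bracketing_lead n0 bt; have E' := bracketing_lead n0 bt'.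
split=> [sat g|homE h].
  by have := sat (Some \o g); rewrite !eval_hom E E'; do 2 case: hom.
have [[i iN hi]|fin] := pselect (exists2 i, i \in iota 1 n & h i = None).
  by rewrite !(@eval_infinity h _ i) // ?bt ?bt'.
have [x0] := vertex_inhabited G.
have hE i : i \in iota 1 n -> h i = Some (odflt x0 (h i)).
  by case hi: (h i) => // iN; case: fin; exists i.
rewrite !(@eq_in_eval _ _ h (Some \o (fun i => odflt x0 (h i)))) ?bt ?bt' //.
by rewrite !eval_hom homE E E'.
Qed.

Definition update s d (x : G) : nat -> G := fun k => if k == d then x else s k.

(** Reading the variables from left to right, it is enough to remember, for
    each depth, the image of the last variable seen at that depth: up to the
    depth of the variable just read, this is the image of the branch to which
    the next variable is attached. *)
Fixpoint run s l : bool :=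
  if l is (d, x) :: l' then
    ((d == 0) || arc (s d.-1) x) && run (update s d x) l'
  else true.

Definition branch_after s l : nat -> G :=
  foldl (fun s dx => update s dx.1 dx.2) s l.

Lemma run_cat s l1 l2 :
  run s (l1 ++ l2) = run s l1 && run (branch_after s l1) l2.
Proof. by elim: l1 s => //= -[d x] l1 IH s; rewrite IH andbA. Qed.

(** Reading a subterm leaves the memory below the depth of its root intact;
    this is what lets the right factor of a product find the root of the left
    one. *)
Lemma branch_after_depths s g b t :
  let s' := branch_after s (zip (depths b t) (map g (vars t))) in
  s' b = g (lead t) /\ forall k, k < b -> s' k = s k.
Proof.
elim: t b s => [i|t1 IH1 t2 IH2] b s /=.
  by rewrite /update eqxx; split=> // k kb; rewrite ltn_eqF.
rewrite map_cat zip_cat ?size_map ?size_depths // /branch_after foldl_cat.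
have [E1 F1] := IH1 b s.
have [_ F2] := IH2 b.+1 (branch_after s (zip (depths b t1) (map g (vars t1)))).
rewrite -!/(branch_after _ _) F2 // E1; split=> // k kb.
by rewrite F2 ?F1 // ltnS ltnW.
Qed.

Lemma run_depths s g b t :
  run s (zip (depths b t) (map g (vars t)))
  = ((b == 0) || arc (s b.-1) (g (lead t))) && hom g t.
Proof.
elim: t b s => [i|t1 IH1 t2 IH2] b s //=.
rewrite map_cat zip_cat ?size_map ?size_depths // run_cat IH1 IH2 /=.
have [-> _] := branch_after_depths s g b t1.
by rewrite (andbC (hom g t2)) !andbA.
Qed.

Definition along w (D : seq nat) : seq (nat * G) := [seq (d, w d) | d <- D].

Lemma branch_after_along w D : branch_after w (along w D) = w.
Proof.
elim: D => //= d D IH; rewrite /branch_after /=.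
suff -> : update w d (w d) = w by [].
by apply: funext => k; rewrite /update; case: eqP => // ->.
Qed.

(** The entries of [s] above [d] are irrelevant, since depths go up by at most
    one at a time. *)
Lemma run_along s w D H d :
  arcs_on w 0 H -> (forall k, k \in D -> k <= H) ->
  (forall k, k <= d -> s k = w k) -> path (fun i j => j <= i.+1) d D ->
  run s (along w D).
Proof.
move=> wH; elim: D d s => //= e D IH d s DH sw /andP[ed eD].
apply/andP; split.
  case: e ed DH {eD} => //= e ed DH; rewrite sw //.
  by apply: wH; rewrite /= DH // mem_head.
apply: (IH e) => // [k kD|k ke]; first by apply: DH; rewrite inE kD orbT.
rewrite /update; case: eqP => [->//|/eqP ne]; apply: sw.
by rewrite -ltnS (leq_trans _ ed) // ltn_neqAle ne.
Qed.

End Homomorphisms.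

(** * What an identity forces on the digraph *)

Section Transfer.
Variable G : digraph.
Implicit Types (w u v : nat -> G).

(** What an identity gives when the first vertex at which the trees differ has
    depth [d] in one tree and [d'] in the other. The tree is mapped by depth, along [w]
    before this vertex and along [w'] from it on; agreement below [d] makes this
    a homomorphism of the first tree, and the arc is the one that the second
    tree requires. All depths are at most [H]. *)
Definition transfer (H d d' : nat) : Prop := forall w w',
  arcs_on w 0 H -> arcs_on w' 0 H -> (forall k, k < d -> w k = w' k) ->
  arc (w d'.-1) (w' d).

Lemma zip_along w D : zip D (map w D) = along w D.
Proof. by elim: D => //= d D ->. Qed.

Lemma transfer_prefix H P d d' R R' :
  0 < d -> 0 < d' -> (forall k, k \in P ++ d :: R -> k <= H) ->
  path (fun i j => j <= i.+1) 0 (P ++ d :: R) ->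
  (forall s (X : seq G), size X = size (P ++ d :: R) ->
     run s (zip (P ++ d :: R) X) = run s (zip (P ++ d' :: R') X)) ->
  transfer H d d'.
Proof.
move=> d0 d'0 leH; rewrite cat_path => /andP[pP /= /andP[_ pR]] runE w w' wH wH' ww'.
have := runE w (map w P ++ map w' (d :: R)).
rewrite !size_cat !size_map => /(_ erefl).
rewrite !zip_cat ?size_map // !run_cat !zip_along branch_after_along.
rewrite (@run_along _ _ _ _ H 0) //; last first.
  by move=> k kP; apply: leH; rewrite mem_cat kP.
rewrite (@run_along _ w w' _ H d.-1) //=; first last.
- by rewrite prednK ?leqnn.
- by move=> k; rewrite -ltnS prednK //; exact: ww'.
- by move=> k kR; apply: leH; rewrite mem_cat kR orbT.
by case: d' d'0 {runE} => //= d' _ /esym/andP[].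
Qed.

(** [d] and [d'] are the entries at the first difference of the two sequences of
    depths. Exchanging the two trees gives the transfer in both directions. *)
Lemma identity_transfer n t t' :
  0 < n -> bracketing n t -> bracketing n t' -> t <> t' ->
  satisfies (@graph_mul G) t t' ->
  exists H d d', [/\ 0 < d, d < d' <= H, transfer H d d' & transfer H d' d].
Proof.
move=> n0 bt bt' ne /(satisfiesP _ n0 bt bt') homE.
have [x0] := vertex_inhabited G.
have sz : size (depths 0 t) = n by rewrite size_depths bt size_iota.
have sz' : size (depths 0 t') = n by rewrite size_depths bt' size_iota.
have runE s (X : seq G) :
    size X = n -> run s (zip (depths 0 t) X) = run s (zip (depths 0 t') X).
  move=> sX; have <- : map (fun i => nth x0 X i.-1) (iota 1 n) = X.
    by rewrite -(addn0 1) iotaDl -map_comp -sX; exact: mkseq_nth.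
  by rewrite -{1}bt -bt' !run_depths /= homE.
have [P [d [d' [R [R' [E E' ndd']]]]]] : exists P d d' R R',
    [/\ depths 0 t = P ++ d :: R, depths 0 t' = P ++ d' :: R' & d <> d'].
  apply: first_difference; first by rewrite sz sz'.
  by move=> /(depths_inj (etrans bt (esym bt'))).
have [r [Er ar pr]] := depths_shape 0 t; have [r' [Er' ar' pr']] := depths_shape 0 t'.
have [d0 d'0] : 0 < d /\ 0 < d'.
  move: E E'; rewrite Er Er'; case: P => [[Ed _] [Ed' _]|_ P [_ E] [_ E']].
    by case: ndd'; rewrite -Ed.
  by split; [apply: (allP ar d) | apply: (allP ar' d')];
     rewrite ?E ?E' mem_cat mem_head orbT.
pose H := \max_(k <- depths 0 t ++ depths 0 t') k.
have leH k : k \in depths 0 t ++ depths 0 t' -> k <= H.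
  by move=> kD; exact: (@leq_bigmax_seq _ _ xpredT id).
have leHt k : k \in P ++ d :: R -> k <= H.
  by move=> kD; apply: leH; rewrite mem_cat E kD.
have leHt' k : k \in P ++ d' :: R' -> k <= H.
  by move=> kD; apply: leH; rewrite mem_cat E' kD orbT.
have T : transfer H d d'.
  apply: (@transfer_prefix H P d d' R R') => //; first by rewrite -E Er /= pr.
  by move=> s X sX; rewrite -E -E' runE // sX -E.
have T' : transfer H d' d.
  apply: (@transfer_prefix H P d' d R' R) => //; first by rewrite -E' Er' /= pr'.
  by move=> s X sX; rewrite -E -E' runE // sX -E'.
have [lt|lt|//] := ltngtP d d'; [exists H, d, d'|exists H, d', d]; split=> //.
  by rewrite lt leHt' // mem_cat mem_head orbT.
by rewrite lt leHt // mem_cat mem_head orbT.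
Qed.

(** With both walks equal to a pleasant path of length more than [H], the
    transferred arc goes back from position [d'.-1] to position [d <= d'.-1],
    which closes a cycle. *)
Lemma pleasant_bounded H d d' (x : G) p :
  d < d' <= H -> transfer H d d' -> pleasant x p -> size p <= H.
Proof.
move=> /andP[dd' d'H] T /andP[wp tp]; rewrite leqNgt; apply/negP => Hp.
pose w := nth x (x :: p).
have wH : arcs_on w 0 H.
  by move=> i /andP[_ iH]; apply: (pathP x wp); exact: ltn_trans Hp.
have back : arc (w d'.-1) (w d) by exact: T.
have lt : d'.-1 < size (x :: p).
  by rewrite ltnS (leq_trans (leq_pred _)) // (leq_trans d'H) // ltnW.
have /(_ _ lt)/asboolP/trivialP := all_nthP x tp; apply; exists (w d) => //.
apply: (reachable_arcs_on wH) => //; last exact: leq_trans (leq_pred _) d'H.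
by rewrite -ltnS prednK // (leq_ltn_trans _ dd').
Qed.

(** Following the blocks cyclically gives a walk [w], and the arc transferred
    along it says that [d] and [d'] agree modulo [m]. *)
Lemma whirl_bounded H d d' (x : G) m : 0 < d ->
  d < d' -> transfer H d d' -> is_whirl (component x) m -> m <= d'.
Proof.
move=> d0 dd' T /whirl_colouring[m0 [c [sur cE]]].
have exw i : exists y, scc x y /\ c y = i %[mod m].
  by have [y] := sur i; exists y.
have [w wP] := choice exw.
have wH : arcs_on w 0 H.
  move=> i _; apply/cE; [exact: (wP i).1|exact: (wP i.+1).1|].
  by rewrite (wP i.+1).2 -addn1 -modnDml -(wP i).2 modnDml addn1.
have /cE : arc (w d'.-1) (w d) by exact: T.
move=> /(_ (wP _).1 (wP _).1) => E.
have {}E : d = d' %[mod m].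
  rewrite -(wP d).2 E -addn1 -modnDml (wP d'.-1).2 modnDml addn1 prednK //.
  exact: ltn_trans dd'.
have : m %| d' - d by rewrite -eqn_mod_dvd ?E // ltnW.
move=> /dvdn_leq; rewrite subn_gt0 => /(_ dd') /leq_trans; apply.
exact: leq_subr.
Qed.

End Transfer.

(** * Regions without dead ends *)

Section Region.
Variables (G : digraph) (S : set G).
Implicit Types (x y z : G) (u v : nat -> G).

Definition walk_in u : Prop := forall k, S (u k) /\ arc (u k) (u k.+1).

Definition twins x y : Prop := forall z, S z -> arc x z = arc y z.

Definition splice n v u : nat -> G := fun k => if k <= n then v k else u (k - n.+1).

Lemma spliceL n v u k : k <= n -> splice n v u k = v k.
Proof. by rewrite /splice => ->. Qed.

Lemma spliceR n v u k : splice n v u (n.+1 + k) = u k.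
Proof. by rewrite /splice leqNgt ltnS leq_addr /= addKn. Qed.

Lemma splice_walk_in n v u :
  walk_in v -> walk_in u -> arc (v n) (u 0) -> walk_in (splice n v u).
Proof.
move=> wv wu vu k; rewrite /splice.
case: (ltngtP k n) => [kn|nk|->]; first exact: wv.
  by rewrite subSn //; exact: wu.
by rewrite subnn; split=> //; exact: (wv n).1.
Qed.

Hypothesis succS : forall x, S x -> exists2 y, S y & arc x y.
Hypothesis predS : forall x, S x -> exists2 y, S y & arc y x.

Lemma future x : S x -> exists2 u, walk_in u & u 0 = x.
Proof.
move=> Sx.
have exf y : exists z, S y -> S z /\ arc y z.
  have [Sy|] := pselect (S y); last by exists y.
  by have [z] := succS Sy; exists z.
have [f fP] := choice exf.
have Si k : S (iter k f x) by elim: k => //= k /fP[].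
by exists (fun k => iter k f x) => // k; split; [exact: Si | exact: (fP _ (Si k)).2].
Qed.

Lemma past n u : walk_in u -> exists2 v, walk_in v & forall k, v (n + k) = u k.
Proof.
elim: n u => [|n IH] u wu; first by exists u.
have [y Sy yu] := predS (wu 0).1; have [v wv v0] := future Sy.
have [|v' wv' E] := IH (splice 0 v u); first by apply: splice_walk_in; rewrite ?v0.
by exists v' => // k; rewrite addSnnS E -add1n spliceR.
Qed.

(** The vertex at depth [d] has to be reached from the root and the remaining
    vertices need images: the walk is prolonged backwards to the root and the
    new arc forwards, and [S] has no dead end in either direction. *)
Lemma transfer_twins H d N : transfer G H d.+1 (d.+1 + N.+1) ->
  transfer G H (d.+1 + N.+1) d.+1 ->
  forall u, walk_in u -> twins (u 0) (u N.+1).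
Proof.
move=> T T' u wu z Sz.
have walk_arcs v : walk_in v -> arcs_on v 0 H by move=> wv i _; exact: (wv i).2.
have [v wv vE] := past d wu; have [f wf f0] := future Sz.
rewrite -(vE 0) -(vE N.+1) addn0.
apply/idP/idP => az.
  have ws : walk_in (splice d v f) by apply: splice_walk_in; rewrite ?f0.
  have := T v _ (walk_arcs _ wv) (walk_arcs _ ws) => /=.
  rewrite -[X in splice _ _ _ X](addn0 d.+1) spliceR f0; apply=> k kd.
  by rewrite spliceL.
have ws : walk_in (splice (d + N.+1) v f) by apply: splice_walk_in; rewrite ?f0.
have := T' v _ (walk_arcs _ wv) (walk_arcs _ ws) => /=.
rewrite addSn -[X in splice _ _ _ X](addn0 (d + N.+1).+1) spliceR f0; apply=> k kd.
by rewrite spliceL.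
Qed.

Variable N : nat.
Hypothesis stepN : forall u, walk_in u -> twins (u 0) (u N.+1).

(** Twice [N.+1], hence at least 2: [arc_twin] and [arc_reversible] need a walk
    that has made two steps. *)
Definition period := (N + N).+2.

Lemma step_period u k : walk_in u -> twins (u k) (u (k + period)).
Proof.
move=> wu z Sz.
have wk j : walk_in (fun i => u (j + i)) by move=> i; rewrite addnS; exact: wu.
have := stepN (wk k) Sz; rewrite /= addn0 => ->.
have := stepN (wk (k + N.+1)) Sz; rewrite /= addn0 => ->.
by rewrite -addnA (addSn N) (addnS N).
Qed.

(** From [y] on, let both vertices follow the same walk: after one period they
    are at the same vertex, which is a twin of each. *)
Lemma twins_of_common_succ x x' y :
  S x -> S x' -> S y -> arc x y -> arc x' y -> twins x x'.
Proof.
move=> Sx Sx' Sy xy x'y z Sz.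
have [u wu u0] := future Sy; have [v wv v0] := future Sx.
have [v' wv' v'0] := future Sx'.
have := step_period 0 (splice_walk_in (n := 0) wv wu _) Sz.
have := step_period 0 (splice_walk_in (n := 0) wv' wu _) Sz.
rewrite !(spliceL _ _ (leqnn 0)) v0 v'0 u0 add0n /period -add1n !spliceR.
by move=> -> // ->.
Qed.

(** Both vertices are one period away from the start of a walk that ends at
    [x]. *)
Lemma twins_of_common_pred x y y' :
  S x -> S y -> S y' -> arc x y -> arc x y' -> twins y y'.
Proof.
move=> Sx Sy Sy' xy xy' z Sz.
have [u wu u0] := future Sy; have [u' wu' u'0] := future Sy'.
have [f wf f0] := future Sx; have [v wv vE] := past (N + N).+1 wf.
have vx : v (N + N).+1 = x by rewrite -f0 -vE addn0.
have := step_period 0 (splice_walk_in (n := (N + N).+1) wv wu _) Sz.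
have := step_period 0 (splice_walk_in (n := (N + N).+1) wv wu' _) Sz.
rewrite !(spliceL _ _ (leq0n _)) vx u0 u'0 add0n /period -(addn0 (N + N).+2) !spliceR u0 u'0.
by move=> <- // <-.
Qed.

(** Walks that start with predecessors of [y] and of [z] can coincide after their
    second step, since twins have the same out-neighbours. After one period
    they are at a common vertex, a twin of both predecessors, hence with arcs to
    both [y] and [z]; and [x] is such a predecessor of [y]. *)
Lemma arc_twin x y z : S x -> S y -> S z -> arc x y -> twins z y -> arc x z.
Proof.
move=> Sx Sy Sz xy zy.
have [u wu u0] := future Sy; have [f wf f0] := future Sx.
have [g wg g0] := future Sz.
have [x' Sx' x'z] := predS Sz; have [f' wf' f'0] := future Sx'.
have wu' : walk_in (fun k => u k.+1) by move=> k; exact: wu.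
have zu : arc (g 0) (u 1) by rewrite g0 (zy _ (wu 1).1) -u0; exact: (wu 0).2.
have wz := splice_walk_in (n := 0) wg wu' zu.
have := step_period 0 (splice_walk_in (n := 0) wf wu _) Sz.
have := step_period 0 (splice_walk_in (n := 0) wf' wz _) Sz.
rewrite !(spliceL _ _ (leqnn 0)) f0 f'0 g0 u0 add0n /period -add1n !spliceR.
by rewrite x'z => /(_ isT) <- /(_ xy).
Qed.

(** After one period, a walk that goes from a predecessor of [x] through [x] and
    [y] is at a twin of this predecessor, hence at a vertex with an arc to
    [x]. *)
Lemma arc_reversible x y : S x -> S y -> arc x y -> reachable y x.
Proof.
move=> Sx Sy xy.
have [v wv v0] := future Sy; have [f wf f0] := future Sx.
have [w Sw wx] := predS Sx; have [g wg g0] := future Sw.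
have fv : arc (f 0) (v 0) by rewrite f0 v0.
have wfv := splice_walk_in (n := 0) wf wv fv.
have := step_period 0 (splice_walk_in (n := 0) wg wfv _) Sx.
rewrite !(spliceL _ _ (leqnn 0)) g0 f0 add0n /period -add1n spliceR -add1n spliceR.
rewrite wx => /(_ isT)/esym vx; apply: reachable_trans (reachable_arc vx).
rewrite -v0; apply: (@reachable_arcs_on _ v 0 (N + N)) => // i _; exact: (wv i).2.
Qed.

Hypothesis sccS : forall x y, S x -> scc x y -> S y.

(** The blocks are the classes of twins: passing to an out-neighbour permutes
    them, and the permutation is cyclic on a strong component. So they can be
    numbered along any infinite walk [u] from [x], and [m] is the first time at
    which [u] comes back to the class of [x]. *)
Lemma region_whirl x : S x -> whirl (component x).
Proof.
move=> Sx; have [u wu u0] := future Sx.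
have Su k : S (u k) := (wu k).1; have au k : arc (u k) (u k.+1) := (wu k).2.
have twinsC a b : twins a b -> twins b a by move=> ab z Sz; rewrite ab.
have twins_trans a b c : twins a b -> twins b c -> twins a c.
  by move=> ab bc z Sz; rewrite ab ?bc.
have up i j : twins (u i) (u j) -> twins (u i.+1) (u j.+1).
  move=> ij; apply: (@twins_of_common_pred (u i)) => //.
  by rewrite ij ?Su // au.
have down i j : twins (u i.+1) (u j.+1) -> twins (u i) (u j).
  move=> ij; apply: (@twins_of_common_succ _ _ (u j.+1)) => //.
  by apply: (@arc_twin _ (u i.+1)) => //; exact: twinsC.
have shift i j k : twins (u i) (u j) <-> twins (u (k + i)) (u (k + j)).
  elim: k => [//|k IH]; rewrite IH !addSn; split; [exact: up|exact: down].
have exm : exists k, (0 < k) && `[< twins (u 0) (u k) >].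
  by exists period; apply/asboolP; exact: (step_period 0).
case: (ex_minnP exm) => m /andP[m0 /asboolP um] mmin.
have modE i : twins (u i) (u (i %% m)).
  rewrite {1}(divn_eq i m); elim: (i %/ m) => [|q IH]; first by rewrite mul0n.
  apply: twins_trans IH; apply: twinsC; rewrite mulSn -addnA [m + _]addnC.
  by rewrite -{1}(addn0 (q * m + _)); exact: (shift _ _ _).1.
have twins_mod i j : twins (u i) (u j) <-> i = j %[mod m].
  split=> [ij|E]; last first.
    by apply: twins_trans (modE i) _; rewrite E; exact: twinsC.
  have {}ij : twins (u (i %% m)) (u (j %% m)).
    by apply: (twins_trans _ _ _ _ (modE j)); apply: twins_trans ij; exact: twinsC.
  have main a b : a <= b -> b < m -> twins (u a) (u b) -> a = b.
    move=> ab bm; rewrite -{1}(addn0 a) -{1}(subnKC ab) => /(shift _ _ _).2 ub.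
    have [ba|ba] := posnP (b - a); first by apply/eqP; rewrite eqn_leq ab -subn_eq0 ba.
    have := mmin (b - a); rewrite ba => /(_ (asboolT ub)) /leq_trans/(_ (leq_subr a b)).
    by rewrite leqNgt bm.
  by case/orP: (leq_total (i %% m) (j %% m)) => le;
    [|apply/esym]; apply: main; rewrite ?ltn_pmod //; exact: twinsC.
have cover y : exists j, scc x y -> twins y (u j).
  have [[[p wp <-] yx]|] := pselect (scc x y); last by exists 0.
  elim/last_ind: p wp yx => [|p z IH]; first by exists 0 => _; rewrite /= u0.
  rewrite /walk rcons_path last_rcons => /andP[wp pz] zx.
  have px : reachable (last x p) x by apply: reachable_trans zx; exact: reachable_arc.
  have sp : scc x (last x p) by split=> //; exists p.
  have sz : scc x z by split=> //; apply: reachable_trans (reachable_arc pz); case: sp.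
  have [j /(_ sp) pj] := IH wp px; exists j.+1 => _.
  have Sz := sccS Sx sz.
  by apply: (@twins_of_common_pred (u j)) => //; rewrite -pj.
have [c cP] := choice cover.
have su k : scc x (u k).
  elim: k => [|k IH]; first by rewrite u0; exact: scc_refl.
  by apply: scc_trans IH _; split; [exact: reachable_arc | exact: arc_reversible].
exists m; apply/whirl_colouring; split=> //; exists c; split=> [i|y z sy sz].
  by exists (u i) => //; apply/twins_mod/twinsC/cP.
have [yc zc] := (cP y sy, cP z sz).
have [Sy Sz] := (sccS Sx sy, sccS Sx sz).
split=> [yz|/twins_mod E].
  apply/twins_mod; apply: twins_trans (twinsC _ _ zc) _.
  by apply: (@twins_of_common_pred (u (c y))) => //; rewrite -yc.
rewrite yc //; apply: (@arc_twin _ (u (c y).+1)) => //.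
exact: twins_trans E.
Qed.

End Region.

Section Between.
Variable G : digraph.
Implicit Types x y z : G.

(** The smallest region that contains all nontrivial components and the paths
    between them; it has no dead ends. *)
Definition between : set G :=
  [set v | exists c d, [/\ cyclic c, cyclic d, reachable c v & reachable v d]].

Lemma reachable_first x y : reachable x y -> x = y \/ exists2 z, arc x z & reachable z y.
Proof.
case=> -[|z p] /= wp <-; [by left|right]; case/andP: wp => xz wp.
by exists z => //; exists p.
Qed.

Lemma reachable_last x y : reachable x y -> x = y \/ exists2 z, reachable x z & arc z y.
Proof.
case; elim/last_ind => [|p z _]; first by move=> _ <-; left.
rewrite /walk rcons_path last_rcons => /andP[wp pz] <-; right.
by exists (last x p) => //; exists p.
Qed.

Lemma cyclic_between x y z :
  cyclic x -> cyclic z -> reachable x y -> reachable y z -> between y.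
Proof. by move=> cx cz xy yz; exists x, z. Qed.

Lemma between_succ x : between x -> exists2 y, between y & arc x y.
Proof.
move=> [c [d [cc cd cx xd]]]; have next y : arc x y -> reachable c y.
  by move=> xy; apply: reachable_trans cx _; exact: reachable_arc.
case: (reachable_first xd) => [E|[y xy yd]]; last first.
  by exists y => //; apply: (cyclic_between cc cd) => //; exact: next.
rewrite -E in cd; have [y xy yx] := cd.
by exists y => //; apply: (cyclic_between cc cd) => //; exact: next.
Qed.

Lemma between_pred x : between x -> exists2 y, between y & arc y x.
Proof.
move=> [c [d [cc cd cx xd]]]; have prev y : arc y x -> reachable y d.
  by move=> yx; apply: reachable_trans xd; exact: reachable_arc.
case: (reachable_last cx) => [E|[y cy yx]]; last first.
  by exists y => //; apply: (cyclic_between cc cd) => //; exact: prev.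
rewrite E in cc; have [z xz zx] := cc.
case: (reachable_last zx) => [Ez|[y zy yx]].
  exists x; last by rewrite -{2}Ez.
  exact: (cyclic_between cc cd (reachable_refl x) xd).
exists y => //; apply: (cyclic_between cc cd); last exact: prev.
exact: reachable_trans (reachable_arc xz) zy.
Qed.

Lemma between_scc x y : between x -> scc x y -> between y.
Proof.
move=> [c [d [cc cd cx xd]]] [xy yx]; exists c, d; split=> //.
  exact: reachable_trans xy.
exact: reachable_trans xd.
Qed.

(** The second conclusion holds because every arc on the way from [x] to [y] lies
    on a cycle, so that the way back exists as well. *)
Lemma identity_conditions n t t' :
  0 < n -> bracketing n t -> bracketing n t' -> t <> t' ->
  satisfies (@graph_mul G) t t' ->
  [/\ forall x : G, ~ trivial (component x) -> whirl (component x),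
      forall x y : G,
        ~ trivial (component x) -> ~ trivial (component y) -> reachable x y -> scc x y,
      exists L : nat, forall (x : G) (p : seq G), pleasant x p -> size p <= L
    & exists M : nat, forall (m : nat) (x : G), is_whirl (component x) m -> m <= M].
Proof.
move=> n0 bt bt' ne sat.
have [H [d [d' [d0 /andP[dd' d'H] T T']]]] := identity_transfer n0 bt bt' ne sat.
have [N stepN] : exists N, forall u, walk_in between u -> twins between (u 0) (u N.+1).
  exists (d' - d).-1; case: d d0 dd' T T' => // d _ dd' T T'.
  have E : d' = d.+1 + (d' - d.+1).-1.+1 by rewrite prednK ?subn_gt0 // subnKC // ltnW.
  by apply: (@transfer_twins _ _ between_succ between_pred H d); rewrite -?E.
split.
- move=> x /nontrivialP cx.
  apply: (region_whirl between_succ between_pred stepN between_scc).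
  exact: (cyclic_between cx cx (reachable_refl x) (reachable_refl x)).
- move=> x y /nontrivialP cx /nontrivialP cy xy; split=> //.
  case: xy => p; move: (reachable_refl x).
  elim: p {2 3 4 5}x => [|z p IH] v xv /=; first by move=> _ ->; exact: reachable_refl.
  case/andP=> vz wp zy; have xz := reachable_trans xv (reachable_arc vz).
  have rzy : reachable z y by exists p.
  apply: reachable_trans (IH z xz wp zy) _.
  apply: (arc_reversible between_succ between_pred stepN) => //.
    by apply: (cyclic_between cx cy) => //; exact: reachable_trans (reachable_arc vz) _.
  exact: (cyclic_between cx cy).
- by exists H => x p; apply: (@pleasant_bounded _ H d d'); rewrite ?dd'.
- by exists d' => m x; exact: (@whirl_bounded _ H d d').
Qed.

End Between.

(** * An identity that the conditions allow *)

Fixpoint chain (a l : nat) : term :=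
  if l is l'.+1 then Mul (Var a) (chain a.+1 l') else Var a.

(** The tree with a trunk of [p + c.+1] vertices and a branch of [r.+1]
    vertices attached to vertex number [p] of the trunk (counting from 0). *)
Fixpoint fork (a p c r : nat) : term :=
  if p is p'.+1 then Mul (Var a) (fork a.+1 p' c r)
  else Mul (chain a c) (chain (a + c).+1 r).

Lemma vars_chain a l : vars (chain a l) = iota a l.+1.
Proof. by elim: l a => //= l IH a; rewrite IH. Qed.

Lemma lead_chain a l : lead (chain a l) = a.
Proof. by case: l. Qed.

Lemma vars_fork a p c r : vars (fork a p c r) = iota a (p + c.+1 + r.+1).
Proof.
elim: p a => [|p IH] a; last by rewrite /= IH.
rewrite -[LHS]/(vars (chain a c) ++ vars (chain (a + c).+1 r)).
by rewrite !vars_chain add0n iotaD addnS.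
Qed.

Lemma lead_fork a p c r : lead (fork a p c r) = a.
Proof. by case: p => //=; exact: lead_chain. Qed.

Lemma fork_inj a p p' c c' r r' :
  0 < c -> 0 < c' -> fork a p c r = fork a p' c' r' -> p = p'.
Proof.
case: c c' => [|c] [|c'] // _ _.
by elim: p p' a => [|p IH] [|p'] a //= [/IH ->].
Qed.

Section ForkHomomorphisms.
Variable G : digraph.
Implicit Types g : nat -> G.

Lemma arcs_on_cons g a b : a < b ->
  arcs_on g a b <-> arc (g a) (g a.+1) /\ arcs_on g a.+1 b.
Proof.
move=> ab; split=> [gab|[ga gb] i /andP[ai ib]].
  split=> [|i /andP[ai ib]]; apply: gab; first by rewrite leqnn.
  by rewrite ltnW.
by move: ai; rewrite leq_eqVlt => /orP[/eqP<- //|ai]; apply: gb; rewrite ai.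
Qed.

Lemma hom_chain g a l : hom g (chain a l) <-> arcs_on g a (a + l).
Proof.
elim: l a => [|l IH] a /=.
  rewrite addn0; split=> // _ i /andP[ai ia].
  by have := leq_trans ia ai; rewrite ltnn.
rewrite arcs_on_cons ?addnS ?ltnS ?leq_addr // -addSn -IH lead_chain.
by split=> [/andP[? ?] //|[? ?]]; apply/andP.
Qed.

Lemma hom_fork g a p c r : hom g (fork a p c r) <->
  [/\ arcs_on g a (a + p + c), arc (g (a + p)) (g (a + p + c).+1)
    & arcs_on g (a + p + c).+1 ((a + p + c).+1 + r)].
Proof.
elim: p a => [|p IH] a /=.
  rewrite addn0 !lead_chain; split=> [/and3P[/hom_chain ? /hom_chain ? ?] //|].
  by move=> [/hom_chain tr ga /hom_chain br]; apply/and3P.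
have lt : a < a + p.+1 + c by rewrite addnS addSn ltnS -addnA leq_addr.
rewrite lead_fork; split=> [/andP[/IH[tr gp br] ga]|[/(arcs_on_cons _ lt)[ga tr] gp br]].
  by rewrite addnS -addSn; split=> //; apply/arcs_on_cons; rewrite // -addnA leq_addr.
by move: tr gp br; rewrite addnS -addSn => tr gp br; apply/andP; split=> //; apply/IH.
Qed.

End ForkHomomorphisms.

Section Sufficiency.
Variables (G : digraph) (L M : nat).
Implicit Types (x y : G) (g : nat -> G).

Hypothesis components_whirl : forall x, ~ trivial (component x) -> whirl (component x).
Hypothesis components_closed : forall x y,
  ~ trivial (component x) -> ~ trivial (component y) -> reachable x y -> scc x y.
Hypothesis pleasant_le : forall (x : G) p, pleasant x p -> size p <= L.
Hypothesis whirl_le : forall m x, is_whirl (component x) m -> m <= M.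

Lemma long_walk_cyclic g a : arcs_on g a (a + L.+1) ->
  exists2 i, a <= i <= a + L.+1 & cyclic (g i).
Proof.
move=> /arcs_on_walk wg; apply: contrapT => nc.
suff /pleasant_le : pleasant (g a) [seq g i | i <- iota a.+1 L.+1].
  by rewrite size_map size_iota ltnn.
apply/andP; split=> //; rewrite -[X in all _ X]/(map g (iota a L.+2)) all_map.
apply/allP => i; rewrite mem_iota addnS ltnS => ai /=.
by apply/asboolP/trivialP => ci; apply: nc; exists i.
Qed.

(** [g] maps a trunk 1, ..., [l] and a branch that starts at [l.+1]. The trunk is
    in a nontrivial component at some time [a] before [i] and [j], and at some
    time [b] after them, hence in the same whirl at all times in between, and in
    the same block of it at times [i] and [j]. The branch is long enough to meet
    a nontrivial component at some time [c]; this can only be the same whirl, so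
    the branch already starts there, in the block after that of [g i] and
    [g j]. *)
Lemma branch_moves g l i j :
  arcs_on g 1 l -> arcs_on g l.+1 (l.+1 + L.+1) ->
  L.+2 <= i -> i + L.+1 <= l -> L.+2 <= j -> j + L.+1 <= l ->
  (forall m, 0 < m <= M -> i = j %[mod m]) ->
  arc (g i) (g l.+1) -> arc (g j) (g l.+1).
Proof.
move=> trunk branch Li il Lj jl ij gi.
have Ll : L.+1 <= l by apply: leq_trans il; exact: leq_addl.
have [a /andP[a1 aL] ca] : exists2 a, 1 <= a <= 1 + L.+1 & cyclic (g a).
  apply: long_walk_cyclic => k /andP[k1 kL]; apply: trunk; rewrite k1.
  by apply: leq_trans kL _; apply: leq_trans Li _; apply: leq_trans il; exact: leq_addr.
have [b /andP[lb bl] cb] : exists2 b, l - L.+1 <= b <= l & cyclic (g b).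
  rewrite -{2}(subnK Ll); apply: long_walk_cyclic => k; rewrite subnK // => /andP[kl kl'].
  apply: trunk; rewrite kl' (leq_trans _ kl) // subn_gt0.
  by apply: leq_trans il; rewrite -[X in X < _]add0n ltn_add2r (leq_trans _ Li).
have [c /andP[lc cl] cc] := long_walk_cyclic branch.
have [ai aj] : a <= i /\ a <= j by split; apply: leq_trans aL _.
have [ib jb] : i <= b /\ j <= b.
  by split; apply: leq_trans lb; rewrite leq_subRL // addnC.
have inC k : a <= k -> k <= b -> scc (g a) (g k).
  move=> ak kb; have gak : reachable (g a) (g k).
    by apply: (reachable_arcs_on trunk) => //; exact: leq_trans bl.
  split=> //; have gkb : reachable (g k) (g b).
    by apply: (reachable_arcs_on trunk) => //; exact: leq_trans ak.
  apply: (reachable_trans gkb).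
  suff [] : scc (g a) (g b) by [].
  apply: components_closed; [exact/nontrivialP..|exact: reachable_trans gak gkb].
have inCl : scc (g a) (g l.+1).
  have gal : reachable (g a) (g l.+1).
    by apply: reachable_trans (reachable_arc gi); case: (inC i).
  have glc : reachable (g l.+1) (g c).
    exact: (reachable_arcs_on branch).
  split=> //; apply: (reachable_trans glc).
  suff [] : scc (g a) (g c) by [].
  apply: components_closed; [exact/nontrivialP..|exact: reachable_trans gal glc].
have [m mW] := components_whirl ((nontrivialP _).2 ca).
have mM := whirl_le mW.
have [m0 [col [_ colE]]] := (whirl_colouring _ _).1 mW.
have colk k : a <= k -> k <= b -> col (g k) + a = col (g a) + k %[mod m].
  move=> /subnKC <-; elim: (k - a) => [|e IH]; first by rewrite addn0.
  rewrite addnS => eb; have /colE : arc (g (a + e)) (g (a + e).+1).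
    apply: trunk; rewrite (leq_trans a1 (leq_addr _ _)) /=; exact: leq_trans bl.
  move=> /(_ (inC _ (leq_addr _ _) (ltnW eb)) (inC _ (leqW (leq_addr _ _)) eb)) E.
  by rewrite -modnDml E modnDml addSn addnS -addn1 -modnDml (IH (ltnW eb)) modnDml addn1.
have cij : col (g i) = col (g j) %[mod m].
  apply/eqP; rewrite -(eqn_modDr a) colk // colk //; apply/eqP.
  by rewrite -modnDmr ij ?m0 // modnDmr.
apply/colE; [exact: inC|exact: inCl|].
rewrite ((colE _ _ (inC _ ai ib) inCl).1 gi).
by rewrite -[in LHS]addn1 -modnDml cij modnDml addn1.
Qed.

(** Variables are numbered from 1, so the branch is attached to [1 + q] in one
    tree and to [1 + q + N] in the other; both have [q] vertices or more on
    either side in the trunk, which is what [branch_moves] asks for. *)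
Lemma exists_identity : ~ antiassociative (@graph_mul G).
Proof.
pose q := L.+1; pose N := M`!.
move=> anti; apply: (anti (q + N + q.+1 + q.+1) (fork 1 q (N + q) q) (fork 1 (q + N) q q)).
- by rewrite addnS.
- by rewrite /bracketing vars_fork -addnS addnA.
- by rewrite /bracketing vars_fork.
- move=> /fork_inj; rewrite addnS /= => /(_ isT isT) /eqP.
  by rewrite -[X in X == _]addn0 eqn_add2l eq_sym eqn0Ngt fact_gt0.
have Nmod m : 0 < m <= M -> 1 + q + N = 1 + q %[mod m].
  move=> mM; apply/eqP; rewrite -[X in _ == X %[mod _]]addn0 eqn_modDl mod0n.
  exact: dvdn_fact.
apply/(@satisfiesP _ (q + N + q.+1 + q.+1)); [by rewrite addnS|..].
- by rewrite /bracketing vars_fork -addnS addnA.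
- by rewrite /bracketing vars_fork.
move=> g; apply/idP/idP => /hom_fork; rewrite !addnA => -[trunk gi branch];
  apply/hom_fork; rewrite !addnA; split=> //.
  apply: (branch_moves trunk branch _ _ _ _ _ gi) => //.
  - by rewrite -!addnA leq_add2l leq_add2l leq_addl.
  - by rewrite -addnA leq_addr.
  - by move=> m mM; rewrite Nmod.
apply: (branch_moves trunk branch _ _ _ _ _ gi) => //.
- by rewrite -addnA leq_addr.
- by rewrite -!addnA leq_add2l leq_add2l leq_addl.
Qed.

End Sufficiency.

Theorem theorem4p12 (G : digraph) :
  ~ antiassociative (@graph_mul G) <->
  [/\ (* (i) *)
      forall x : G, ~ trivial (component x) -> whirl (component x),
      (* (ii) *)
      forall x y : G,
        ~ trivial (component x) -> ~ trivial (component y) -> scc x <> scc y ->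
        ~ exists (u : G) (p : seq G),
            [/\ scc x u, dipath u p & scc y (last u p)],
      (* (iii) *)
      exists L : nat, forall (x : G) (p : seq G),
        dipath x p -> pleasant x p -> size p <= L
    & (* (iv) *)
      exists M : nat, forall (m : nat) (x : G),
        is_whirl (component x) m -> m <= M].
Proof.
split=> [nanti|[whirls closed [L pleasant_le] [M whirl_le]]].
  have [n [t [t' [[n0 bt] [bt' ne] sat]]]] : exists n t t',
      [/\ 0 < n /\ bracketing n t, bracketing n t' /\ t <> t'
        & satisfies (@graph_mul G) t t'].
    apply: contrapT => none; apply: nanti => n t t' n0 bt bt' ne sat.
    by apply: none; exists n, t, t'.
  have [whirls closed [L pleasant_le] bounded] := identity_conditions n0 bt bt' ne sat.
  split=> //; last by exists L => x p _; exact: pleasant_le.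
  move=> x y ntx nty nxy [u [p [xu /andP[wp _] yp]]]; apply: nxy; apply: scc_eq.
  apply: closed => //; apply: reachable_trans xu.1 _.
  by apply: reachable_trans yp.2; exists p.
apply: (@exists_identity G L M) => //; last first.
  by move=> x p px; apply: (pleasant_le x) => //; exact: pleasant_dipath.
move=> x y ntx nty /reachable_dipath[p xp py]; apply: contrapT => nxy.
apply: (closed x y ntx nty); last first.
  by exists x, p; split=> //; [exact: scc_refl | rewrite py; exact: scc_refl].
by move=> E; apply: nxy; rewrite E; exact: scc_refl.
Qed.
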